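(* Let $a\in(0,1)$ and $p\in[1,\infty)$. Then the $L_p$-quadrant discrepancy at $a$ suffers from the curse of dimensionality, i.e., the quantity $$N_{L_p^{\boxplus,(a)}}(\varepsilon,d):=\min\{N\in\mathbb{N}:\ \exists\,\mathcal{P}\subseteq[0,1)^d\text{ such that }|\mathcal{P}|=N\text{ and }L_p^{\boxplus,(a)}(\mathcal{P})\le\varepsilon\,L_p^{\boxplus,(a)}(\emptyset)\}$$ grows exponentially fast with the dimension $d$. In more detail, $$N_{L_p^{\boxplus,(a)}}(\varepsilon,d)\ge C_{p,1}^d\,(1-\varepsilon)\quad\text{for all }\varepsilon\in(0,1)\text{ and }d\in\mathbb{N},$$ where $$C_{p,1}=1+\left(\frac{1}{\max(a,1-a)}-1\right)^{p+1}>1.$$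
   Context: For a point set $\mathcal{P}=\{\boldsymbol{y}_1,\ldots,\boldsymbol{y}_N\}$ in $[0,1)^d$, the $L_p$-quadrant discrepancy at $a$ is $$L_p^{\boxplus,(a)}(\mathcal{P})=\left(\int_{[0,1]^d}\left|\frac1N\sum_{k=1}^N\mathbf{1}_{Q(\boldsymbol{t})}(\boldsymbol{y}_k)-\mathrm{Vol}(Q(\boldsymbol{t}))\right|^p\mathrm{d}\boldsymbol{t}\right)^{1/p},$$ where for $\boldsymbol{t}=(t_1,\dots,t_d)\in[0,1]^d$ the test set is $Q(\boldsymbol{t})=Q(t_1)\times\cdots\times Q(t_d)$ with $Q(t)=[0,t)$ if $t<a$ and $Q(t)=[t,1)$ if $t\ge a$, $\mathbf{1}$ denotes the indicator function and $\mathrm{Vol}$ the volume. The initial discrepancy (counting term omitted) is $$L_p^{\boxplus,(a)}(\emptyset)=\left(\int_{[0,1]^d}\mathrm{Vol}(Q(\boldsymbol{t}))^p\,\mathrm{d}\boldsymbol{t}\right)^{1/p}=\left(\frac{a^{p+1}+(1-a)^{p+1}}{p+1}\right)^{d/p}.$$ $\mathbb{N}=\{1,2,\dots\}$; the minimum of the empty set is $\infty$. *)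

(* Defs.v *)
From HB Require Import structures.
From mathcomp Require Import all_boot all_order all_algebra finmap.
From mathcomp Require Import all_classical all_reals all_analysis.

Set Implicit Arguments.
Unset Strict Implicit.
Unset Printing Implicit Defensive.

Import Order.TTheory GRing.Theory Num.Theory.

Local Open Scope classical_set_scope.
Local Open Scope ring_scope.

Section LebesgueTuple.
Context {R : realType}.
Local Notation T := (measurableTypeR R).

Definition cons_pair (n : nat) (z : T * n.-tuple T) : n.+1.-tuple T :=
  [tuple of z.1 :: z.2].

Definition uncons_pair (n : nat) (x : n.+1.-tuple T) : T * n.-tuple T :=
  (thead x, [tuple of behead x]).

Lemma cons_pairK n : cancel (@cons_pair n) (@uncons_pair n).
Proof. by move=> [a s]; congr pair; exact: val_inj. Qed.

Lemma measurable_cons_pair n : measurable_fun setT (@cons_pair n).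
Proof. exact: measurable_cons. Qed.

Lemma measurable_uncons_pair n : measurable_fun setT (@uncons_pair n).
Proof.
apply: measurable_fun_pair; first exact: measurable_tnth.
apply/measurable_fun_tnthP => i.
rewrite (_ : _ \o _ = @tnth _ T ^~ (lift ord0 i)); first exact: measurable_tnth.
apply/funext => x /=; rewrite tnth_behead; congr tnth.
by apply/val_inj; rewrite /= inordK // ltnS.
Qed.

(* The product lebesgue_measure \x mu lives on T * n.-tuple T; it is
   transported to n.+1.-tuple T along (a, s) |-> a :: s. *)
Definition lebesgue_cons (n : nat)
    (mu : {sigma_finite_measure set (n.-tuple T) -> \bar R}) :
    set (n.+1.-tuple T) -> \bar R :=
  pushforward (lebesgue_measure \x mu)%E (@cons_pair n).

Section lebesgue_cons_instance.
Variables (n : nat) (mu : {sigma_finite_measure set (n.-tuple T) -> \bar R}).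

Let lebesgue_cons0 : lebesgue_cons mu set0 = 0%E.
Proof. by rewrite /lebesgue_cons /pushforward preimage_set0 measure0. Qed.

Let lebesgue_cons_ge0 A : (0 <= lebesgue_cons mu A)%E.
Proof. by rewrite /lebesgue_cons /pushforward measure_ge0. Qed.

Let lebesgue_cons_sigma_additive : semi_sigma_additive (lebesgue_cons mu).
Proof.
exact: (@measure_semi_sigma_additive _ _ _
  (measure_function_pushforward__canonical__measure_function_Measure
     (lebesgue_measure \x mu)%E (@measurable_cons_pair n))).
Qed.

HB.instance Definition _ := isMeasure.Build _ _ _ (lebesgue_cons mu)
  lebesgue_cons0 lebesgue_cons_ge0 lebesgue_cons_sigma_additive.

Let lebesgue_cons_sigma_finite : sigma_finite setT (lebesgue_cons mu).
Proof.
have /sigma_finiteP[F [FT Fnd Fm]] :=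
  sigma_finiteT (@lebesgue_measure R : {sigma_finite_measure set T -> \bar R}).
have /sigma_finiteP[G [GT Gnd Gm]] := sigma_finiteT mu.
exists (fun k => @uncons_pair n @^-1` (F k `*` G k)).
  rewrite -preimage_bigcup (_ : \bigcup_k _ = setT) ?preimage_setT //.
  apply/seteqP; split=> // -[x y] _.
  have [i _ Fix] : (\bigcup_i F i) x by rewrite -FT.
  have [k _ Gky] : (\bigcup_i G i) y by rewrite -GT.
  exists (maxn i k) => //; split.
    by move: x Fix; exact/subsetPset/Fnd/leq_maxl.
  by move: y Gky; exact/subsetPset/Gnd/leq_maxr.
move=> k; have [mF Foo] := Fm k; have [mG Goo] := Gm k; split.
  rewrite -[X in measurable X]setTI.
  by apply: measurable_uncons_pair => //; exact: measurableX.
rewrite /lebesgue_cons /pushforward -comp_preimage.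
rewrite (_ : _ \o _ = id); last by apply/funext => z; exact: cons_pairK.
by rewrite preimage_id product_measure1E// lte_mul_pinfty// ge0_fin_numE.
Qed.

HB.instance Definition _ := Measure_isSigmaFinite.Build _ _ _
  (lebesgue_cons mu) lebesgue_cons_sigma_finite.

End lebesgue_cons_instance.

(* Lebesgue measure on R^n, as the n-fold product of lebesgue_measure; R^0 is a
   single point of mass 1. *)
Fixpoint lebesgue_tuple (n : nat) :
    {sigma_finite_measure set (n.-tuple T) -> \bar R} :=
  match n with
  | 0%N => \d_([tuple] : 0.-tuple T)
  | m.+1 => lebesgue_cons (lebesgue_tuple m)
  end.

Definition box (n : nat) (A : 'I_n -> set T) : set (n.-tuple T) :=
  [set x | forall i, A i (tnth x i)].

Lemma measurable_box n (A : 'I_n -> set T) :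
  (forall i, measurable (A i)) -> measurable (box A).
Proof.
move=> mA.
have -> : box A = \bigcap_(i in [set: 'I_n])
    ((fun x : n.-tuple T => tnth x i) @^-1` A i).
  by apply/seteqP; split=> x /= Ax i => [_|]; exact: Ax.
apply: fin_bigcap_measurable => [|i _]; first exact: finite_finset.
by rewrite -[X in measurable X]setTI; exact: measurable_tnth.
Qed.

Lemma preimage_cons_pair_box n (A : 'I_n.+1 -> set T) :
  @cons_pair n @^-1` box A = A ord0 `*` box (fun i => A (lift ord0 i)).
Proof.
apply/seteqP; split=> [[x y] /= Axy|[x y] /= [Ax Ay] i].
  split=> [|i]; first exact: (Axy ord0).
  by have := Axy (lift ord0 i); rewrite tnthS.
by case: (unliftP ord0 i) => [j|] ->; rewrite ?tnthS //; exact: Ay.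
Qed.

Lemma lebesgue_tuple_box n (A : 'I_n -> set T) :
  (forall i, measurable (A i)) ->
  lebesgue_tuple n (box A) = (\prod_(i < n) lebesgue_measure (A i))%E.
Proof.
elim: n A => [|n IHn] A mA.
  by rewrite big_ord0 /= diracE mem_set // => -[].
rewrite big_ord_recl -IHn //= /lebesgue_cons /pushforward.
rewrite preimage_cons_pair_box product_measure1E //.
by apply: measurable_box => i; exact: mA.
Qed.

End LebesgueTuple.

Section QuadrantDiscrepancy.
Context {R : realType}.
Implicit Types (a p : R) (d : nat).

Definition quadrant1 a (t : R) : set R :=
  if t < a then `[0, t[%classic else `[t, 1[%classic.

Definition quadrant a d (t : d.-tuple R) : set (d.-tuple R) :=
  box (fun i => quadrant1 a (tnth t i)).

Definition closed_cube d : set (d.-tuple R) := box (fun=> `[0, 1]%classic).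

Definition half_open_cube d : set (d.-tuple R) := box (fun=> `[0, 1[%classic).

Definition vol d (A : set (d.-tuple R)) : R := fine (lebesgue_tuple d A).

(* A point set is a set: its #|` P| points are pairwise distinct. *)
Definition local_discrepancy a d (P : {fset d.-tuple R}) (t : d.-tuple R) : R :=
  (#|` P|%:R)^-1 * \sum_(y <- P) \1_(quadrant a t) y - vol (quadrant a t).

Definition quadrant_discrepancy a p d (P : {fset d.-tuple R}) : \bar R :=
  ((\int[lebesgue_tuple d]_(t in @closed_cube d)
     (`|local_discrepancy a P t|%R `^ p)%:E) `^ p^-1)%E.

(* The discrepancy with the counting term omitted. *)
Definition initial_discrepancy a p d : \bar R :=
  ((\int[lebesgue_tuple d]_(t in @closed_cube d)
     (vol (quadrant a t) `^ p)%:E) `^ p^-1)%E.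

Definition min_nat (A : set nat) : \bar R :=
  if pselect (exists N, `[< A N >]) is left exA then ((ex_minn exA)%:R)%:E
  else +oo%E.

Definition inverse_discrepancy a p (eps : R) d : \bar R :=
  min_nat [set N | (0 < N)%N /\ exists P : {fset d.-tuple R},
    [/\ [set` P] `<=` @half_open_cube d, #|` P| = N &
        (quadrant_discrepancy a p P <=
          eps%:E * initial_discrepancy a p d)%E]].

(* Lower bound C (1 + c)^d, uniform in eps near 0 and valid in every dimension
   d >= 1 (some authors only ask for infinitely many d). *)
Definition curse_of_dimensionality (Ninv : R -> nat -> \bar R) : Prop :=
  exists C c eps0 : R, [/\ 0 < C, 0 < c, 0 < eps0 &
    forall (eps : R) (d : nat), 0 < eps -> eps <= eps0 -> (0 < d)%N ->
      ((C * (1 + c) ^+ d)%:E <= Ninv eps d)%E].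

End QuadrantDiscrepancy.

(* Main.v *)
(* A point y lies in Q(t) only if t lies in a box whose sides are each [0, a)
   or [a, 1], and the integral of Vol(Q(t))^p over such a box is at most
   (max(a, 1 - a)^(p+1) / (p+1))^d. Outside the N boxes of the points of P the
   local discrepancy equals -Vol(Q(t)), so the p-th power of the discrepancy is
   at least the p-th power of the initial one minus N times that bound; the
   ratio of the initial p-th power to the bound is C^d. *)
Require Import Defs.
From mathcomp Require Import all_boot all_order all_algebra finmap.
From mathcomp Require Import all_classical all_reals all_analysis.
From mathcomp Require Import unstable measurable_realfun.
From mathcomp Require Import ring lra.

Import Order.TTheory GRing.Theory Num.Theory.
Import numFieldNormedType.Exports.

Local Open Scope classical_set_scope.
Local Open Scope ring_scope.

(** * One-dimensional integrals of power functions *)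

(** Regularity needed for the fundamental theorem of calculus. The endpoint 0 is treated apart,
    since for [q < 1] the power is not differentiable there; [0 < q] gives the limit 0. *)
Lemma derivable_oo_LRcontinuous_powR {R : realType} (q b : R) :
  0 < q -> 0 < b -> derivable_oo_LRcontinuous (@powR R ^~ q) 0 b.
Proof.
move=> q0 b0; split.
- move=> x /[!in_itv]/= /andP[x0 _].
  by apply: derivable_powR; rewrite in_itv/= x0.
- by rewrite /= powR0 ?gt_eqF//; exact: powR_cvg0.
- have db : derivable (@powR R ^~ q) b 1.
    by apply: derivable_powR; rewrite in_itv/= b0.
  apply: cvg_at_left_filter.
  exact: (differentiable_continuous (proj1 (derivable1_diffP _ _) db)).
Qed.

Lemma integral_powR {R : realType} (p b : R) : 0 < p -> 0 < b ->
  (\int[lebesgue_measure]_(x in `[0%R, b]) (x `^ p)%:E =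
   (b `^ (p + 1) / (p + 1))%:E)%E.
Proof.
move=> p0 b0.
have q0 : 0 < p + 1 by rewrite addr_gt0.
have [dq cq0 cqb] := derivable_oo_LRcontinuous_powR _ _ q0 b0.
rewrite (@continuous_FTC2 _ _ (fun x => (p + 1)^-1 * x `^ (p + 1)) _ _ b0).
- by rewrite powR0 ?gt_eqF// mulr0 sube0 mulrC.
- exact/derivable_oo_LRcontinuous_within/derivable_oo_LRcontinuous_powR.
- split.
  + by move=> x xb; apply: derivableM => //; exact: dq.
  + by apply: cvgM => //; exact: cvg_cst.
  + by apply: cvgM => //; exact: cvg_cst.
- move=> x xb.
  have x0 : x \in `]0, +oo[ by move: xb; rewrite !in_itv/= andbT => /andP[].
  rewrite derive1E deriveM//; last exact: dq.
  rewrite derive_cst scaler0 addr0 -derive1E powR_derive1//.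
  by rewrite /GRing.scale/= mulrA mulVf ?gt_eqF// mul1r addrK.
Qed.

Lemma integral_onem_powR {R : realType} (p a : R) : 0 < p -> 0 < a -> a < 1 ->
  (\int[lebesgue_measure]_(x in `[a, 1%R]) ((1 - x) `^ p)%:E =
   ((1 - a) `^ (p + 1) / (p + 1))%:E)%E.
Proof.
move=> p0 a0 a1.
have b0 : 0 < 1 - a by rewrite subr_gt0.
rewrite -(integral_powR _ _ p0 b0).
rewrite (@integration_by_substitution_onem _ (@powR R ^~ p)).
- by rewrite /onem subKr.
- by rewrite ltW//= gerBl ltW.
- exact/derivable_oo_LRcontinuous_within/derivable_oo_LRcontinuous_powR.
Qed.

(** * Integrals of product functions over boxes *)

Lemma measurable_fun_tuple_prod {R : realType} {n} (f : 'I_n -> R -> R) :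
  (forall i, measurable_fun [set: measurableTypeR R] (f i)) ->
  measurable_fun [set: n.-tuple (measurableTypeR R)]
    (fun t : n.-tuple (measurableTypeR R) => \prod_(i < n) f i (tnth t i)).
Proof.
move=> mf; apply: measurable_prod => i _.
by apply: (measurableT_comp (mf i)); exact: measurable_tnth.
Qed.

(** Induction on [n]: the measure is the pushforward of a product along [cons_pair], so Tonelli
    splits off the first coordinate. For [n = 0] the unit Dirac mass gives the empty product. *)
Lemma integral_lebesgue_tuple_prod {R : realType} {n} (f : 'I_n -> R -> R) :
  (forall i, measurable_fun [set: measurableTypeR R] (f i)) ->
  (forall i x, 0 <= f i x) ->
  (\int[lebesgue_tuple n]_t (\prod_(i < n) f i (tnth t i))%:E =
   \prod_(i < n) \int[lebesgue_measure]_x (f i x)%:E)%E.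
Proof.
elim: n f => [|n IHn] f mf f0.
  rewrite big_ord0 /= integral_dirac//=; last first.
    by apply/measurable_EFinP; exact: measurable_fun_tuple_prod.
  by rewrite diracT mul1e big_ord0.
have mF := measurable_fun_tuple_prod _ mf.
pose g (i : 'I_n) := f (lift ord0 i).
have mG : measurable_fun [set: n.-tuple (measurableTypeR R)]
    (fun t => \prod_(i < n) g i (tnth t i)).
  by apply: measurable_fun_tuple_prod => i; exact: mf.
rewrite /= /lebesgue_cons ge0_integral_pushforward//=; last 3 first.
- exact: measurable_cons_pair.
- exact/measurable_EFinP.
- by move=> t _; rewrite lee_fin; apply: prodr_ge0 => i _; exact: f0.
rewrite preimage_setT fubini_tonelli1; last 2 first.
- apply/measurable_EFinP/(measurableT_comp mF); exact: measurable_cons_pair.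
- by move=> z; rewrite lee_fin; apply: prodr_ge0 => i _; exact: f0.
rewrite big_ord_recl -(IHn g); last 2 first.
- by move=> i; exact: mf.
- by move=> i x; exact: f0.
rewrite -ge0_integralZr//; last 3 first.
- exact/measurable_EFinP.
- by move=> x _; rewrite lee_fin.
- apply: integral_ge0 => t _; rewrite lee_fin.
  by apply: prodr_ge0 => i _; exact: f0.
apply: eq_integral => x _; rewrite /fubini_F.
rewrite -ge0_integralZl//; last 3 first.
- exact/measurable_EFinP.
- by move=> t _; rewrite lee_fin; apply: prodr_ge0 => i _; exact: f0.
- by rewrite lee_fin.
apply: eq_integral => t _; rewrite -EFinM big_ord_recl; congr (_ * _)%:E.
by apply: eq_bigr => i _; rewrite tnthS.
Qed.

(** The indicator of a box is the product of the indicators of its sides, so restricting each [f i]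
    to [A i] reduces the claim to the whole space. *)
Lemma integral_box_prod {R : realType} {n} (A : 'I_n -> set R)
    (f : 'I_n -> R -> R) :
  (forall i, measurable (A i : set (measurableTypeR R))) ->
  (forall i, measurable_fun [set: measurableTypeR R] (f i)) ->
  (forall i x, 0 <= f i x) ->
  (\int[lebesgue_tuple n]_(t in box A) (\prod_(i < n) f i (tnth t i))%:E =
   \prod_(i < n) \int[lebesgue_measure]_(x in A i) (f i x)%:E)%E.
Proof.
move=> mA mf f0; rewrite integral_mkcond.
under [RHS]eq_bigr => i _ do rewrite integral_mkcond.
under [RHS]eq_bigr => i _ do under eq_integral => x _ do
  rewrite restrict_EFin.
rewrite -(integral_lebesgue_tuple_prod (fun i => f i \_ (A i))); last 2 first.
- move=> i; apply/(measurable_restrictT _ (mA i)).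
  exact: measurable_funS (mf i).
- by move=> i x; rewrite patchE; case: ifP => // _; exact: f0.
apply: eq_integral => t _; rewrite restrict_EFin; congr EFin.
rewrite patchE; case: ifPn => [|/negP] tA.
  by apply: eq_bigr => i _; rewrite patchE mem_set//; exact: (set_mem tA).
have [i Ai] : exists i, ~ A i (tnth t i).
  by apply/existsNP => At; apply: tA; exact: mem_set.
by rewrite (bigD1 i)//= patchE memNset// mul0r.
Qed.

(** * Volumes of quadrants and measurability in the parameter [t] *)

Lemma powR_prod {R : realType} {I : Type} (s : seq I) (f : I -> R) (p : R) :
  (forall i, 0 <= f i) ->
  (\prod_(i <- s) f i) `^ p = \prod_(i <- s) f i `^ p.
Proof.
move=> f0; elim: s => [|i s IHs]; first by rewrite !big_nil powR1.
by rewrite !big_cons powRM ?IHs// prodr_ge0.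
Qed.

(* The length of Q(s) for every real s, not only in [0, 1]; totality and
   nonnegativity let the product formulas hold without side conditions. *)
Definition quadrant_length {R : realType} (a s : R) : R :=
  Num.max 0 (if s < a then s else 1 - s).

Lemma quadrant_length_ge0 {R : realType} (a s : R) : 0 <= quadrant_length a s.
Proof. by rewrite le_max lexx. Qed.

Lemma measurable_quadrant_length {R : realType} (a : R) :
  measurable_fun [set: measurableTypeR R] (quadrant_length a).
Proof.
apply: measurable_maxr => //; apply: measurable_fun_ifT => //.
- exact: measurable_fun_ltr.
- exact: measurable_funB.
Qed.

Lemma measurable_quadrant_lengthX {R : realType} (a p : R) :
  measurable_fun [set: measurableTypeR R] (fun s => quadrant_length a s `^ p).
Proof.
exact: (measurableT_comp (measurable_powR p) (measurable_quadrant_length a)).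
Qed.

Lemma measurable_quadrant1 {R : realType} (a s : R) :
  measurable (quadrant1 a s : set (measurableTypeR R)).
Proof. by rewrite /quadrant1; case: ifP. Qed.

Lemma lebesgue_measure_quadrant1 {R : realType} (a s : R) :
  lebesgue_measure (quadrant1 a s) = (quadrant_length a s)%:E.
Proof.
rewrite /quadrant1 /quadrant_length.
case: ifP => _; rewrite lebesgue_measure_itv/= lte_fin.
- by case: ltP => s0; rewrite ?sube0.
- by rewrite -subr_gt0; case: ltP.
Qed.

Lemma vol_quadrant {R : realType} (a : R) {d} (t : d.-tuple R) :
  vol (quadrant a t) = \prod_(i < d) quadrant_length a (tnth t i).
Proof.
rewrite /vol /quadrant lebesgue_tuple_box; last first.
  by move=> i; exact: measurable_quadrant1.
under eq_bigr do rewrite lebesgue_measure_quadrant1.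
by rewrite prodEFin.
Qed.

Lemma vol_quadrantX {R : realType} (a p : R) {d} (t : d.-tuple R) :
  vol (quadrant a t) `^ p = \prod_(i < d) quadrant_length a (tnth t i) `^ p.
Proof.
by rewrite vol_quadrant powR_prod// => i; exact: quadrant_length_ge0.
Qed.

(** Here [y] is fixed and the parameter [s] varies: an [s] below [a] qualifies when [0 <= y < s],
    any other when [s <= y < 1]. *)
Lemma measurable_mem_quadrant1 {R : realType} (a y : R) :
  measurable ([set s | quadrant1 a s y] : set (measurableTypeR R)).
Proof.
rewrite (_ : [set s | _] =
    (if 0 <= y then `]y, a[%classic else set0) `|`
    (if y < 1 then `[a, y]%classic else set0)).
  by apply: measurableU; case: ifP.
apply/seteqP; split=> s /=; rewrite /quadrant1.
- case: ltP => sa /=; rewrite in_itv/= => /andP[y1 y2].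
    by left; rewrite y1 /= in_itv/= y2.
  by right; rewrite y2 /= in_itv/= sa.
- case=> [|]; case: ifP => //= y0; rewrite in_itv/= => /andP[h1 h2].
    by rewrite h2 /= in_itv/= y0.
  by rewrite ltNge h1 /= in_itv/= h2.
Qed.

Lemma measurable_vol_quadrantX {R : realType} (a p : R) {d} :
  measurable_fun [set: d.-tuple (measurableTypeR R)]
    (fun t => vol (quadrant a t) `^ p).
Proof.
under eq_fun do rewrite vol_quadrantX.
apply: (measurable_fun_tuple_prod (fun=> fun s => quadrant_length a s `^ p)).
by move=> _; exact: measurable_quadrant_lengthX.
Qed.

Lemma measurable_local_discrepancy {R : realType} (a : R) {d}
    (P : {fset d.-tuple R}) :
  measurable_fun [set: d.-tuple (measurableTypeR R)] (local_discrepancy a P).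
Proof.
rewrite /local_discrepancy; apply: measurable_funB; last first.
  under eq_fun do rewrite vol_quadrant.
  apply: (measurable_fun_tuple_prod (fun=> quadrant_length a)) => _.
  exact: measurable_quadrant_length.
apply: measurable_funM => //; apply: measurable_sum => y.
(* For fixed [y], the condition that [quadrant a t] contains [y] splits over the coordinates of [t],
   so it describes a box of parameters. *)
rewrite (_ : (fun t => _) =
    \1_(box (fun i => [set s | quadrant1 a s (tnth y i)]))).
  apply: measurable_indic; apply: measurable_box => i.
  exact: measurable_mem_quadrant1.
by apply/funext => t; rewrite !indicE; congr (_%:R);
  apply/idP/idP => /set_mem yt; exact: mem_set.
Qed.

(** * The two cells of [0, 1] cut at [a] *)

(** A superset of the parameters [s] in [0, 1] with [y] in Q(s). It depends only on the side of [a]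
    where [y] lies, so just two integrals occur. *)
Definition quadrant_cell {R : realType} (a y : R) : set R :=
  if y < a then `[0, a[%classic else `[a, 1]%classic.

Lemma measurable_quadrant_cell {R : realType} (a y : R) :
  measurable (quadrant_cell a y : set (measurableTypeR R)).
Proof. by rewrite /quadrant_cell; case: ifP. Qed.

Lemma sub_quadrant_cell {R : realType} (a y : R) : 0 < a -> a < 1 ->
  quadrant_cell a y `<=` `[0, 1]%classic.
Proof.
move=> a0 a1 s; rewrite /quadrant_cell.
by case: ifP => _ /=; rewrite !in_itv/= => /andP[]; lra.
Qed.

(** If [s < a], then [y < s] forces [y < a]; if [a <= s], then [s <= y] forces [a <= y]. So [s] and
    [y] lie on the same side of [a]. *)
Lemma quadrant1_cell {R : realType} (a y s : R) :
  `[0, 1]%classic s -> quadrant1 a s y -> quadrant_cell a y s.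
Proof.
rewrite /= in_itv/= => /andP[s0 s1]; rewrite /quadrant1 /quadrant_cell.
case: ltP => sa /=; rewrite in_itv/= => /andP[y0 y1].
- by rewrite (lt_trans y1 sa) /= in_itv/= s0.
- by rewrite ltNge (le_trans sa y0) /= in_itv/= sa.
Qed.

Lemma integral_quadrant_cell {R : realType} (a p y : R) :
  0 < a -> a < 1 -> 0 < p ->
  (\int[lebesgue_measure]_(s in quadrant_cell a y)
     (quadrant_length a s `^ p)%:E =
   ((if y < a then a else 1 - a) `^ (p + 1) / (p + 1))%:E)%E.
Proof.
move=> a0 a1 p0; rewrite /quadrant_cell; case: ifP => _.
(* The endpoint [a] is a null set, so the half-open cell may be closed. *)
- rewrite -(integral_powR _ _ p0 a0) -integral_itv_bndo_bndc; last first.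
    by apply/measurable_EFinP; apply: measurable_funTS; exact: measurable_powR.
  apply: eq_integral => s; rewrite inE/= in_itv/= => /andP[s0 sa].
  by rewrite /quadrant_length sa max_r.
- rewrite -(integral_onem_powR _ _ p0 a0 a1); apply: eq_integral => s.
  rewrite inE/= in_itv/= => /andP[s0 s1].
  by rewrite /quadrant_length ltNge s0 /= max_r// subr_ge0.
Qed.

Lemma integral_quadrant_length {R : realType} (a p : R) :
  0 < a -> a < 1 -> 0 < p ->
  (\int[lebesgue_measure]_(s in `[0%R, 1%R]) (quadrant_length a s `^ p)%:E =
   ((a `^ (p + 1) + (1 - a) `^ (p + 1)) / (p + 1))%:E)%E.
Proof.
move=> a0 a1 p0.
have mq := measurable_quadrant_lengthX a p.
(* The points 0 and [a] represent the two sides of [a]; their cells partition [0, 1]. *)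
rewrite (_ : `[0, 1]%classic = quadrant_cell a 0 `|` quadrant_cell a a).
  rewrite ge0_integral_setU//=.
  - by rewrite !integral_quadrant_cell// a0 ltxx -EFinD mulrDl.
  - exact: measurable_quadrant_cell.
  - exact: measurable_quadrant_cell.
  - exact/measurable_EFinP/measurable_funTS.
  - by move=> s _; rewrite lee_fin powR_ge0.
  - apply/disj_set2P/seteqP; split=> // s; rewrite /quadrant_cell a0 ltxx /=.
    by rewrite !in_itv/= => -[/andP[]]; lra.
apply/seteqP; split => s; last by case; exact: sub_quadrant_cell.
rewrite /quadrant_cell a0 ltxx /= !in_itv/= => /andP[s0 s1].
by case: (ltP s a) => sa; [left; rewrite s0|right].
Qed.

(** * Integrals of the volume power over the cube and over cell boxes *)

Lemma integral_vol_quadrantX {R : realType} (a p : R) d (A : 'I_d -> set R) :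
  (forall i, measurable (A i : set (measurableTypeR R))) ->
  (\int[lebesgue_tuple d]_(t in box A) (vol (quadrant a t) `^ p)%:E =
   \prod_(i < d) \int[lebesgue_measure]_(s in A i)
     (quadrant_length a s `^ p)%:E)%E.
Proof.
move=> mA; under eq_integral do rewrite vol_quadrantX.
apply: (integral_box_prod A (fun=> fun s => quadrant_length a s `^ p)) => //.
- by move=> _; exact: measurable_quadrant_lengthX.
- by move=> _ s; exact: powR_ge0.
Qed.

Lemma integral_vol_closed_cube {R : realType} (a p : R) d :
  0 < a -> a < 1 -> 0 < p ->
  (\int[lebesgue_tuple d]_(t in @closed_cube R d) (vol (quadrant a t) `^ p)%:E =
   (((a `^ (p + 1) + (1 - a) `^ (p + 1)) / (p + 1)) ^+ d)%:E)%E.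
Proof.
move=> a0 a1 p0; rewrite integral_vol_quadrantX//.
under eq_bigr do rewrite integral_quadrant_length//.
by rewrite prodEFin prodr_const card_ord.
Qed.

Definition quadrant_box {R : realType} (a : R) {d} (y : d.-tuple R) :=
  box (fun i => quadrant_cell a (tnth y i)).

Lemma measurable_quadrant_box {R : realType} (a : R) {d} (y : d.-tuple R) :
  measurable (quadrant_box a y : set (d.-tuple (measurableTypeR R))).
Proof. by apply: measurable_box => i; exact: measurable_quadrant_cell. Qed.

(** Each coordinate contributes the integral over one of the two cells; bounding it by the larger
    one removes the dependence on [y]. *)
Lemma integral_vol_quadrant_box {R : realType} (a p : R) {d}
    (y : d.-tuple R) : 0 < a -> a < 1 -> 0 < p ->
  (\int[lebesgue_tuple d]_(t in quadrant_box a y)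
     (vol (quadrant a t) `^ p)%:E <=
   ((Num.max a (1 - a) `^ (p + 1) / (p + 1)) ^+ d)%:E)%E.
Proof.
move=> a0 a1 p0; have q0 : 0 < p + 1 by rewrite addr_gt0.
rewrite integral_vol_quadrantX; last first.
  by move=> i; exact: measurable_quadrant_cell.
under eq_bigr do rewrite integral_quadrant_cell//.
rewrite prodEFin lee_fin -[in leRHS](card_ord d) -prodr_const.
apply: ler_prod => i _; rewrite divr_ge0 ?powR_ge0 ?(ltW q0)//=.
rewrite ler_pM2r ?invr_gt0//.
have a1' : 0 <= 1 - a by rewrite subr_ge0 ltW.
apply: (ge0_ler_powR (ltW q0)).
- by rewrite nnegrE; case: ifP => // _; exact: ltW.
- by rewrite nnegrE le_max (ltW a0).
- by rewrite le_max; case: ifP; rewrite lexx ?orbT.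
Qed.

(** * Comparison of the discrepancy with the initial discrepancy *)

(** If Q(t) contains a point of [P], then [t] lies in the box of that point and this single summand
    equals the left side. Otherwise, also for empty [P], the counting term is 0 and the discrepancy
    term equals it. *)
Lemma vol_le_local_discrepancy {R : realType} (a p : R) {d}
    (P : {fset d.-tuple R}) (t : d.-tuple R) : closed_cube t ->
  ((vol (quadrant a t) `^ p)%:E <=
   (`|local_discrepancy a P t| `^ p)%:E + \sum_(y <- P)
     ((fun t => (vol (quadrant a t) `^ p)%:E) \_ (quadrant_box a y)) t)%E.
Proof.
move=> t01.
have g0 (y : d.-tuple R) : (0 <=
    ((fun t => (vol (quadrant a t) `^ p)%:E) \_ (quadrant_box a y)) t)%E.
  by rewrite patchE; case: ifP => // _; rewrite lee_fin powR_ge0.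
have [[y yP Qy]|noQ] := pselect (exists2 y, y \in P & quadrant a t y).
- rewrite (big_fsetD1 y)//= [in leRHS]patchE mem_set; last first.
    by move=> i; apply: quadrant1_cell (t01 i) (Qy i).
  by rewrite addeCA leeDl// adde_ge0// ?lee_fin ?powR_ge0// sume_ge0//.
- rewrite /local_discrepancy big_seq big1; last first.
    move=> y yP; rewrite indicE memNset// => Qy; apply: noQ.
    by exists y.
  rewrite mulr0 sub0r normrN ger0_norm; last first.
    by rewrite vol_quadrant prodr_ge0// => i _; exact: quadrant_length_ge0.
  by rewrite leeDl// sume_ge0.
Qed.

(** Integrates the pointwise bound over the cube: each point of [P] costs at most one box
    integral. *)
Lemma integral_vol_le_discrepancy {R : realType} (a p : R) {d}
    (P : {fset d.-tuple R}) : 0 < a -> a < 1 -> 0 < p ->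
  ((((a `^ (p + 1) + (1 - a) `^ (p + 1)) / (p + 1)) ^+ d)%:E <=
   \int[lebesgue_tuple d]_(t in @closed_cube R d)
     (`|local_discrepancy a P t| `^ p)%:E +
   (#|` P|%:R * (Num.max a (1 - a) `^ (p + 1) / (p + 1)) ^+ d)%:E)%E.
Proof.
move=> a0 a1 p0; rewrite -integral_vol_closed_cube//.
have mC : measurable (@closed_cube R d : set (d.-tuple (measurableTypeR R))).
  exact: measurable_box.
have mV := measurable_vol_quadrantX a p (d := d).
have mD : measurable_fun [set: d.-tuple (measurableTypeR R)]
    (fun t => `|local_discrepancy a P t| `^ p).
  apply: (measurableT_comp (measurable_powR p)).
  by apply: measurableT_comp => //; exact: measurable_local_discrepancy.
pose g (y : d.-tuple R) :=
  (fun t => (vol (quadrant a t) `^ p)%:E) \_ (quadrant_box a y).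
have g0 y t : (0 <= g y t)%E.
  by rewrite /g patchE; case: ifP => // _; rewrite lee_fin powR_ge0.
have mg y : measurable_fun [set: d.-tuple (measurableTypeR R)] (g y).
  apply/(measurable_restrictT _ (measurable_quadrant_box a y)).
  exact/measurable_EFinP/measurable_funTS.
apply: (@le_trans _ _ (\int[lebesgue_tuple d]_(t in @closed_cube R d)
    ((`|local_discrepancy a P t| `^ p)%:E + \sum_(y <- P) g y t))%E).
  apply: ge0_le_integral => //.
  - by move=> t _; rewrite lee_fin powR_ge0.
  - exact/measurable_EFinP/measurable_funTS.
  - apply: emeasurable_funD.
      by apply/measurable_EFinP; exact: measurable_funTS.
    by apply: emeasurable_sum => y; apply: measurable_funTS; exact: mg.
  - by move=> t; exact: vol_le_local_discrepancy.
rewrite ge0_integralD//; first last.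
- by apply: emeasurable_sum => y; apply: measurable_funTS; exact: mg.
- by move=> t _; exact: sume_ge0.
- by apply/measurable_EFinP; exact: measurable_funTS.
rewrite leeD2l// ge0_integral_sum//; last first.
  by move=> y; apply: measurable_funTS; exact: mg.
apply: (@le_trans _ _ (\sum_(y <- P)
    ((Num.max a (1 - a) `^ (p + 1) / (p + 1)) ^+ d)%:E)%E).
  (* Every box lies in the closed cube, so intersecting it with the cube changes nothing. *)
  apply: lee_sum => y _; rewrite /g -integral_mkcondr setIC setIidl; last first.
    by move=> t yt i; exact: sub_quadrant_cell (yt i).
  exact: integral_vol_quadrant_box.
by rewrite sumEFin big_const_seq count_predT iter_addr_0 mulr_natl.
Qed.

(** * The constant and the lower bound on the number of points *)

(** With [x] the larger and [y] the smaller of [a] and [1 - a], [x + y = 1] gives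
    [x^-1 - 1 = y / x]. The right side is the integral over [0, 1] divided by the larger cell
    integral, the factors [p + 1] cancelling. *)
Lemma ratio_powR_max {R : realType} (a q : R) : 0 < a -> a < 1 ->
  1 + ((Num.max a (1 - a))^-1 - 1) `^ q =
  (a `^ q + (1 - a) `^ q) / Num.max a (1 - a) `^ q.
Proof.
move=> a0 a1; have b0 : 0 < 1 - a by rewrite subr_gt0.
have ratio x y : 0 < x -> 0 < y -> x + y = 1 ->
    1 + (x^-1 - 1) `^ q = (x `^ q + y `^ q) / x `^ q.
  move=> x0 y0 xy1.
  have -> : x^-1 - 1 = y * x^-1.
    by rewrite (_ : y = 1 - x); [field; rewrite gt_eqF|lra].
  rewrite powRM ?invr_ge0 ?ltW// -(powR_inv1 (ltW x0)) -powRrM mulN1r powRN.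
  by rewrite mulrDl divff ?gt_eqF ?powR_gt0.
case: (leP a (1 - a)) => _.
- by rewrite (ratio _ _ b0 a0) ?subrK// [a `^ q + _]addrC.
- by rewrite (ratio _ _ a0 b0)// addrC subrK.
Qed.

Lemma discrepancy_card_ge {R : realType} (a p eps : R) {d}
    (P : {fset d.-tuple R}) :
  0 < a -> a < 1 -> 1 <= p -> 0 < eps -> eps < 1 ->
  (quadrant_discrepancy a p P <= eps%:E * initial_discrepancy a p d)%E ->
  (1 + ((Num.max a (1 - a))^-1 - 1) `^ (p + 1)) ^+ d * (1 - eps) <=
  #|` P|%:R.
Proof.
move=> a0 a1 p1 e0 e1; have p0 : 0 < p by exact: lt_le_trans p1.
have q0 : 0 < p + 1 by rewrite addr_gt0.
have M0 : 0 < Num.max a (1 - a) by rewrite lt_max a0.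
rewrite /quadrant_discrepancy /initial_discrepancy integral_vol_closed_cube//.
have := integral_vol_le_discrepancy _ _ P a0 a1 p0.
(* [I] and [D] are the p-th powers of the initial discrepancy and of the discrepancy of [P]; [B]
   bounds one box integral. *)
set I := (_ ^+ d); set D := (\int[_]_(_ in _) _)%E; set B := _ ^+ d.
have B0 : 0 < B by rewrite exprn_gt0// divr_gt0// powR_gt0.
have -> : (1 + ((Num.max a (1 - a))^-1 - 1) `^ (p + 1)) ^+ d = I / B.
  rewrite ratio_powR_max// /I /B -expr_div_n; congr (_ ^+ d).
  by field; rewrite !gt_eqF ?powR_gt0.
have I0 : 0 <= I.
  by rewrite exprn_ge0// divr_ge0 ?(ltW q0)// addr_ge0// powR_ge0.
have D0 : (0 <= D)%E by apply: integral_ge0 => t _; rewrite lee_fin powR_ge0.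
move=> ID DI.
(* Raising to the power [p] removes the roots. This takes place in the extended reals, as [D] is not
   yet known to be finite. *)
have {}DI : (D <= (eps `^ p * I)%:E)%E.
  have : ((D `^ p^-1) `^ p <= (eps%:E * I%:E `^ p^-1) `^ p)%E.
    apply: gt0_ler_poweR => //; rewrite ?in_itv/= ?leey ?andbT ?poweR_ge0//.
    - exact: ltW.
    - by rewrite -EFinM lee_fin mulr_ge0 ?powR_ge0 ?ltW.
  rewrite poweRM ?poweR_ge0// ?lee_fin ?(ltW e0)// -!poweRrM mulVf ?gt_eqF//.
  by rewrite !poweRe1// lee_fin.
have {}ID : I <= eps `^ p * I + #|` P|%:R * B.
  rewrite -lee_fin EFinD; apply: (le_trans ID); exact: leeD2r.
(* Here [1 <= p] enters: it turns the factor [1 - eps ^ p] into the linear [1 - eps]. *)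
have ep : eps `^ p <= eps by apply: ge1r_powR => //; rewrite e0 ltW.
rewrite mulrAC ler_pdivrMr//.
have : eps `^ p * I <= eps * I by exact: ler_wpM2r.
lra.
Qed.

Theorem corollary3 (R : realType) (a p : R)
    (ha0 : 0 < a) (ha1 : a < 1) (hp : 1 <= p) :
  let C := 1 + ((Num.max a (1 - a))^-1 - 1) `^ (p + 1) in
  [/\ curse_of_dimensionality (inverse_discrepancy a p),
      (forall (eps : R) (d : nat), 0 < eps -> eps < 1 -> (0 < d)%N ->
        ((C ^+ d * (1 - eps))%:E <= inverse_discrepancy a p eps d)%E) &
      1 < C].
Proof.
move=> C.
have C1 : 1 < C.
  rewrite ltrDl powR_gt0// subr_gt0 invf_gt1; last by rewrite lt_max ha0.
  by rewrite gt_max ha1 gtrBl.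
have Cbound (eps : R) (d : nat) : 0 < eps -> eps < 1 -> (0 < d)%N ->
    ((C ^+ d * (1 - eps))%:E <= inverse_discrepancy a p eps d)%E.
  move=> e0 e1 _; rewrite /inverse_discrepancy /min_nat.
  (* If no [N] qualifies, the value is [+oo]; otherwise the minimum is attained by some [P], to
     which the cardinality bound applies. *)
  case: pselect => [exA|_]; last exact: leey.
  case: ex_minnP => N /asboolP[_ [P [_ <- PD]]] _.
  by rewrite lee_fin; exact: discrepancy_card_ge PD.
(* For [eps <= 1/2] the factor [1 - eps] is at least [1/2], which serves as the uniform constant;
   the growth rate is [1 + (C - 1) = C]. *)
split=> //; exists 2^-1, (C - 1), 2^-1; split; rewrite ?subr_gt0 ?invr_gt0//.
move=> eps d e0 e2 d0; apply: le_trans (Cbound eps d e0 _ d0); last by lra.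
have Cd0 : 0 <= C ^+ d by rewrite exprn_ge0// ltW// (lt_trans ltr01).
rewrite lee_fin [1 + _]addrC subrK mulrC ler_wpM2l//; lra.
Qed.
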